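(* Let $V$ be a finite-dimensional complex vector space and let $p,q\ge0$ be integers. For $l=0,1,2,\ldots$ let $\mathcal{L}^{(q)}_l$ be the set of all linear combinations of the operators on $T^{(q)}_p(V)$ of the form $$L(v_l)\cdots L(v_1)\,L(\sigma)\,L(v_1^* )\cdots L(v_l^* ),\qquad v_i\in V,\ v_j^*\in V^*,\ \sigma\in S_{l+q}.$$ Then: (i) As sets of operators on $T^{(q)}_p(V)$, $\mathcal{L}^{(q)}_0\subset\mathcal{L}^{(q)}_1\subset\cdots\subset\mathcal{L}^{(q)}_p$, and $\mathcal{L}^{(q)}_l=\{0\}$ for $l>p$. (ii) Let $R$ denote right multiplication by $\mathbb{C}S_{p+q}$ on $T^{(q)}_p(V)$. Then $R(\mathbb{C}S_{p+q})$ and $\mathcal{L}^{(q)}_p$ are mutual commutants of each other in $\operatorname{End}_{\mathbb{C}}(T^{(q)}_p(V))$.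
   Context: Permutations multiply by composition; $S_\infty$ is the inductive limit of $S_0\subset S_1\subset\cdots$, and $s_i=(i\ \,i{+}1)$. The symbol $\otimes$ is omitted in tensors, and vectors are numbered from right to left. $V^{\otimes p}$ is a right $\mathbb{C}S_p$-module by $v_p\cdots v_1\,\sigma=v_{\sigma(p)}\cdots v_{\sigma(1)}$. Put $T^{(q)}_p(V)=V^{\otimes p}\otimes_{\mathbb{C}S_p}\mathbb{C}S_{p+q}$ and $\bar T_p(V)=V^{\otimes p}\otimes_{\mathbb{C}S_p}\mathbb{C}S_\infty$, so $T^{(q)}_p(V)\subset\bar T_p(V)$, and $\bar T(V)=\bigoplus_{p\ge0}\bar T_p(V)$. This is an associative graded algebra with product $$(v_p\cdots v_1\,\sigma)(v'_{p'}\cdots v'_1\,\sigma')=v_p\cdots v_1v'_{p'}\cdots v'_1\,\alpha^{p'}(\sigma)\sigma',$$ where $\alpha$ is the group endomorphism of $S_\infty$ with $\alpha(\sigma)(1)=1$, $\alpha(\sigma)(k)=\sigma(k-1)+1$ for $k\ge2$. $L(\varphi)$ is left multiplication by $\varphi\in\bar T(V)$ (in particular for $\varphi=v\in V$ or $\varphi=\sigma\in S_\infty\subset\bar T_0(V)$). For $v^*\in V^*$, $L(v^* )$ is the operator on $\bar T(V)$ with $$L(v^* )\,v_p\cdots v_1\,t=\sum_{k=1}^p\langle v^*,v_k\rangle\,v_p\cdots\hat v_k\cdots v_1\cdot(p\ \,p{-}1\ \cdots\ k{+}1\ \,k)\,t\qquad(t\in\mathbb{C}S_\infty),$$ where $\hat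 v_k$ means omission and $(p\ p{-}1\cdots k)$ is the cycle $p\mapsto p-1\mapsto\cdots\mapsto k\mapsto p$; $L(v^* )t=0$ for $p=0$. The operators displayed in the claim map $T^{(q)}_p(V)$ into itself. The commutant of a set $\mathcal D\subset\operatorname{End}_{\mathbb C}(U)$ is the set of all elements of $\operatorname{End}_{\mathbb C}(U)$ commuting with every element of $\mathcal D$. *)

(* Defs.v *)
From HB Require Import structures.
From mathcomp Require Import all_boot all_order all_algebra.
From mathcomp Require Import finmap.
From mathcomp Require Import generic_quotient ring_quotient.
From mathcomp Require Import boolp classical_sets functions zify.
From mathcomp.multinomials Require Import monalg.

Set Implicit Arguments.
Unset Strict Implicit.
Unset Printing Implicit Defensive.

Import GRing.Theory.
Local Open Scope ring_scope.
Local Open Scope quotient_scope.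
Local Open Scope classical_set_scope.

(* Positions are numbered from 0: the integer k >= 1 of the usual convention  *)
(* is k.-1 here, and S_n is the set of permutations fixing every k >= n.      *)
Definition finperm_pred (f : nat -> nat) : bool :=
  `[< bijective f /\ exists n, forall k, (n <= k)%N -> f k = k >].

Record Sinf := MkSinf { sfun :> nat -> nat; _ : finperm_pred sfun }.

HB.instance Definition _ := [isSub for sfun].
HB.instance Definition _ := [Choice of Sinf by <:].

Lemma SinfP (s t : Sinf) : s =1 t -> s = t.
Proof. by move=> e; apply: val_inj; apply: funext. Qed.

Lemma Sinf_bij (s : Sinf) : bijective s.
Proof. by case: s => f /= /asboolP[]. Qed.

Lemma Sinf_fix (s : Sinf) : exists n, forall k, (n <= k)%N -> s k = k.
Proof. by case: s => f /= /asboolP[]. Qed.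

Definition Sn (n : nat) : set Sinf :=
  [set s | forall k, (n <= k)%N -> s k = k].

Lemma finperm_predI f g n : cancel f g -> cancel g f ->
  (forall k, (n <= k)%N -> f k = k) -> finperm_pred f.
Proof. by move=> fK gK h; apply/asboolP; split; [exists g|exists n]. Qed.

Lemma Sinf_id_subproof : finperm_pred id.
Proof. exact: (@finperm_predI id id 0). Qed.

Lemma Sinf_comp_subproof (s t : Sinf) : finperm_pred (s \o t).
Proof.
apply/asboolP; split; first exact: bij_comp (Sinf_bij s) (Sinf_bij t).
have [m hm] := Sinf_fix s; have [n hn] := Sinf_fix t.
by exists (maxn m n) => k; rewrite geq_max => /andP[mk nk] /=; rewrite hn ?hm.
Qed.

Lemma Sinf_inv_ex (s : Sinf) : {g : nat -> nat | cancel s g /\ cancel g s}.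
Proof. by apply: cid; case: (Sinf_bij s) => g sK gK; exists g. Qed.

Lemma Sinf_inv_subproof (s : Sinf) : finperm_pred (sval (Sinf_inv_ex s)).
Proof.
case: Sinf_inv_ex => g /= [sK gK]; have [n hn] := Sinf_fix s.
by apply: (finperm_predI (n := n) gK sK) => k /hn {1}<-.
Qed.

(* The product is composition of functions, (s * t) k = s (t k), unlike that  *)
(* of {perm T} in MathComp.                                                   *)
Definition Sinf_one := MkSinf Sinf_id_subproof.
Definition Sinf_mul s t := MkSinf (Sinf_comp_subproof s t).
Definition Sinf_inv s := MkSinf (Sinf_inv_subproof s).

Lemma Sinf_mulA : associative Sinf_mul.
Proof. by move=> s t u; apply: SinfP. Qed.
Lemma Sinf_mul1 : left_id Sinf_one Sinf_mul.
Proof. by move=> s; apply: SinfP. Qed.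
Lemma Sinf_mul1r : right_id Sinf_one Sinf_mul.
Proof. by move=> s; apply: SinfP. Qed.
Lemma Sinf_mulV : left_inverse Sinf_one Sinf_inv Sinf_mul.
Proof. by move=> s; apply: SinfP => k /=; case: Sinf_inv_ex => g /= []. Qed.
Lemma Sinf_mulVr : right_inverse Sinf_one Sinf_inv Sinf_mul.
Proof. by move=> s; apply: SinfP => k /=; case: Sinf_inv_ex => g /= []. Qed.

HB.instance Definition _ := isGroup.Build Sinf
  Sinf_mulA Sinf_mul1 Sinf_mul1r Sinf_mulV Sinf_mulVr.

Lemma SinfME (s t : Sinf) k : (s * t)%g k = s (t k). Proof. by []. Qed.
Lemma Sinf1E k : (1%g : Sinf) k = k. Proof. by []. Qed.

Lemma Sinf_inj (s : Sinf) : injective s.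
Proof. exact: bij_inj (Sinf_bij s). Qed.

Lemma SinfVK (s : Sinf) : cancel s (s^-1)%g.
Proof. by move=> k; rewrite -SinfME mulVg. Qed.
Lemma SinfKV (s : Sinf) : cancel (s^-1)%g s.
Proof. by move=> k; rewrite -SinfME mulgV. Qed.

Lemma Sn1 n : Sn n 1%g. Proof. by []. Qed.

Lemma SnM n s t : Sn n s -> Sn n t -> Sn n (s * t)%g.
Proof. by move=> hs ht k nk; rewrite SinfME ht ?hs. Qed.

Lemma SnV n s : Sn n s -> Sn n s^-1%g.
Proof. by move=> hs k nk; apply: (@Sinf_inj s); rewrite -SinfME mulgV hs. Qed.

Lemma SnW m n s : (m <= n)%N -> Sn m s -> Sn n s.
Proof. by move=> mn hs k nk; rewrite hs // (leq_trans mn). Qed.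

Lemma Sn_lt n s k : Sn n s -> (k < n)%N -> (s k < n)%N.
Proof.
move=> hs kn; rewrite ltnNge; apply/negP => nk.
by have /Sinf_inj e := hs _ nk; move: kn; rewrite -e ltnNge nk.
Qed.

Definition alpha_fun (s : nat -> nat) (k : nat) : nat :=
  if k is k'.+1 then (s k').+1 else 0.

Lemma alpha_subproof (s : Sinf) : finperm_pred (alpha_fun s).
Proof.
have [n hn] := Sinf_fix s.
apply: (@finperm_predI _ (alpha_fun (s^-1%g : Sinf)) n.+1).
- by case=> [|k] //; rewrite /alpha_fun SinfVK.
- by case=> [|k] //; rewrite /alpha_fun SinfKV.
- by case=> //= k nk; rewrite hn.
Qed.

Definition alpha (s : Sinf) : Sinf := MkSinf (alpha_subproof s).

Definition cyc_fun (p k j : nat) : nat :=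
  if (k <= j < p)%N then if j == k then p.-1 else j.-1 else j.

Definition cycV_fun (p k j : nat) : nat :=
  if (k <= j < p)%N then if j == p.-1 then k else j.+1 else j.

Lemma cyc_subproof p k : finperm_pred (cyc_fun p k).
Proof.
apply: (@finperm_predI _ (cycV_fun p k) p).
- move=> j; rewrite /cyc_fun /cycV_fun.
  case H: (k <= j < p)%N; last by rewrite H.
  by case: (eqVneq j k) H => [->|jk] H; do ?case: ifP; lia.
- move=> j; rewrite /cyc_fun /cycV_fun.
  case H: (k <= j < p)%N; last by rewrite H.
  by case: (eqVneq j p.-1) H => [->|jk] H; do ?case: ifP; lia.
- by move=> j pj; rewrite /cyc_fun ltnNge pj andbF.
Qed.

(* For k < p this is p-1 -> p-2 -> .. -> k -> p-1, that is, the cycle        *)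
(* (p p-1 .. k+1) on positions numbered from 1; for k >= p it is 1.           *)
Definition cyc (p k : nat) : Sinf := MkSinf (cyc_subproof p k).

Lemma cycE p k j : cyc p k j = cyc_fun p k j. Proof. by []. Qed.

Lemma Sn_cyc p k : Sn p (cyc p k).
Proof. by move=> j pj; rewrite cycE /cyc_fun [(j < p)%N]ltnNge pj andbF. Qed.

Lemma cyc_k p k : (k < p)%N -> cyc p k k = p.-1.
Proof. by move=> kp; rewrite cycE /cyc_fun leqnn kp eqxx. Qed.

Lemma cyc_bump p k j : (j < p.-1)%N -> cyc p k (bump k j) = j.
Proof. by rewrite cycE /cyc_fun /bump => jp; do ?case: ifP; lia. Qed.

Lemma bump_cyc p k j : (k < p)%N -> (j < p)%N -> j <> k ->
  bump k (cyc p k j) = j.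
Proof. by rewrite cycE /cyc_fun /bump => kp jp jk; do ?case: ifP; lia. Qed.

Lemma Sn_alpha n s : Sn n s -> Sn n.+1 (alpha s).
Proof. by move=> hs [|k] //= nk; rewrite hs. Qed.

Lemma alphaE n (s : Sinf) k :
  iter n alpha s k = if (k < n)%N then k else (s (k - n) + n)%N.
Proof.
elim: n k => [|n IH] [|k] //=; rewrite ?addn0 //.
by rewrite IH ltnS subSS addnS; case: ifP.
Qed.

Lemma Sn_alphan m n s : Sn n s -> Sn (m + n) (iter m alpha s).
Proof. by move=> hs; elim: m => //= m; apply: Sn_alpha. Qed.

Lemma alphanM n s t :
  iter n alpha (s * t)%g = (iter n alpha s * iter n alpha t)%g.
Proof.
apply: SinfP => k; rewrite SinfME !alphaE; case: ltnP => [->//|nk].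
by rewrite ltnNge leq_addl /= addnK.
Qed.

Lemma alphan1 n : iter n alpha 1%g = 1%g.
Proof.
by apply: SinfP => k; rewrite alphaE Sinf1E; case: ltnP => // ?; rewrite subnK.
Qed.

(* Elements of the symmetric groups on complementary positions commute.       *)
Lemma alphan_comm n s t : Sn n t ->
  (iter n alpha s * t)%g = (t * iter n alpha s)%g.
Proof.
move=> ht; apply: SinfP => k; rewrite !SinfME !alphaE.
case: (ltnP k n) => kn; first by rewrite Sn_lt.
by rewrite (ht k kn) ltnNge kn /= [RHS]ht // leq_addl.
Qed.

Section LinearSpan.
Context {K : fieldType} {M : lmodType K}.

Definition lspan (S : set M) : set M :=
  [set x | exists n (c : 'I_n -> K) (y : 'I_n -> M),
     (forall i, S (y i)) /\ x = \sum_(i < n) c i *: y i].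

Lemma lspan_gen S x : S x -> lspan S x.
Proof.
move=> Sx; exists 1%N, (fun=> 1), (fun=> x); split=> //.
by rewrite big_ord1 scale1r.
Qed.

Lemma lspan0 S : lspan S 0.
Proof. by exists 0%N, (fun=> 0), (fun=> 0); split=> [[]|]; rewrite ?big_ord0. Qed.

Lemma lspanD S x y : lspan S x -> lspan S y -> lspan S (x + y).
Proof.
move=> [m [c [u [Su ->]]]] [n [d [v [Sv ->]]]]; exists (m + n)%N.
exists (fun i => match fintype.split i with inl j => c j | inr j => d j end).
exists (fun i => match fintype.split i with inl j => u j | inr j => v j end); split.
  by move=> i; case: (fintype.split i).
rewrite big_split_ord /=; congr (_ + _); apply: eq_bigr => i _.
  by rewrite (unsplitK (inl i)).
by rewrite (unsplitK (inr i)).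
Qed.

Lemma lspanZ S a x : lspan S x -> lspan S (a *: x).
Proof.
move=> [m [c [u [Su ->]]]]; exists m, (fun i => a * c i), u; split=> //.
by rewrite scaler_sumr; apply: eq_bigr => i _; rewrite scalerA.
Qed.

Lemma lspan_sum S I (r : seq I) (P : pred I) (F : I -> M) :
  (forall i, P i -> lspan S (F i)) -> lspan S (\sum_(i <- r | P i) F i).
Proof.
move=> h; elim/big_rec : _ => [|i x Pi]; first exact: lspan0.
by move=> Sx; apply: lspanD Sx; apply: h.
Qed.

Definition lspanp (S : set M) : {pred M} := fun x => `[< lspan S x >].

Lemma lspanp_submod S : submod_closed (lspanp S).
Proof.
split=> [|a x y /asboolP Sx /asboolP Sy]; apply/asboolP; first exact: lspan0.
by apply: lspanD Sy; apply: lspanZ.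
Qed.

HB.instance Definition _ S :=
  GRing.isSubmodClosed.Build K M (lspanp S) (lspanp_submod S).

End LinearSpan.

Lemma lspan_img (K : fieldType) (M N : lmodType K) (f : M -> N) S S' :
  linear f -> (forall x, S x -> lspan S' (f x)) ->
  forall x, lspan S x -> lspan S' (f x).
Proof.
move=> flin h x [n [c [y [Sy ->]]]].
pose g : {linear M -> N} := HB.pack f (GRing.isLinear.Build _ _ _ _ f flin).
rewrite -[f]/(g : _ -> _) linear_sum; apply: lspan_sum => i _.
by rewrite linearZ; apply: lspanZ; apply: h.
Qed.

Lemma linear_comb (K : fieldType) (M N : lmodType K) a (f g : M -> N) :
  linear f -> linear g -> linear (fun x => a *: f x + g x).
Proof.
move=> flin glin b x y; rewrite flin glin !scalerDr !scalerA [a * b]mulrC.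
by rewrite addrACA.
Qed.

(* Linear extension to the free module on W of a map defined on W.            *)
Section LinearExtension.
Context {K : fieldType} {W : choiceType} {M : lmodType K}.
Implicit Types (F : W -> M) (g : {malg K[W]}).

Definition lext F g : M := \sum_(k <- msupp g) g@_k *: F k.

Lemma lextEw F g (d : {fset W}) : (msupp g `<=` d)%fset ->
  lext F g = \sum_(k <- d) g@_k *: F k.
Proof.
move=> gd; apply: big_fset_incl gd _ => k _ kg.
by rewrite mcoeff_outdom ?scale0r.
Qed.

Lemma lext_linear F : linear (lext F).
Proof.
move=> a g h; pose d := (msupp g `|` msupp h `|` msupp (a *: g + h))%fset.
rewrite !(@lextEw _ _ d); first 1 last.
- by rewrite /d -fsetUA fsetUCA fsubsetUl.
- by rewrite /d -fsetUA fsubsetUl.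
- by rewrite /d fsubsetUr.
rewrite scaler_sumr -big_split; apply: eq_bigr => k _ /=.
by rewrite mcoeffD mcoeffZ scalerDl scalerA.
Qed.

HB.instance Definition _ F :=
  GRing.isLinear.Build K {malg K[W]} M *:%R (lext F) (lext_linear F).

Lemma lextU F k : lext F << k >> = F k.
Proof.
rewrite (@lextEw _ _ [fset k]%fset) ?msuppU_le // big_seq_fset1.
by rewrite mcoeffUU scale1r.
Qed.

Lemma lext_eq F F' g : F =1 F' -> lext F g = lext F' g.
Proof. by move=> e; apply: eq_bigr => k _; rewrite e. Qed.

End LinearExtension.

(* A word w = [:: v_{p-1}; ..; v_1; v_0] stands for a decomposable tensor;    *)
(* its vectors are numbered from right to left.                               *)
Section Words.
Context {K : fieldType} {V : vectType K}.
Implicit Type w : seq V.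

Definition entry w (k : nat) : V := nth 0 (rev w) k.

Definition word_act w (s : nat -> nat) : seq V :=
  rev (mkseq (fun k => entry w (s k)) (size w)).

Definition word_del w (k : nat) : seq V :=
  rev (mkseq (fun j => entry w (bump k j)) (size w).-1).

Lemma size_word_act w s : size (word_act w s) = size w.
Proof. by rewrite size_rev size_mkseq. Qed.

Lemma size_word_del w k : size (word_del w k) = (size w).-1.
Proof. by rewrite size_rev size_mkseq. Qed.

Lemma entry_act w s k : (k < size w)%N -> entry (word_act w s) k = entry w (s k).
Proof. by move=> kw; rewrite /entry revK nth_mkseq. Qed.

Lemma entry_del w k j : (j < (size w).-1)%N ->
  entry (word_del w k) j = entry w (bump k j).
Proof. by move=> kw; rewrite /entry revK nth_mkseq. Qed.

Lemma entry_cat w w' k : entry (w ++ w') k =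
  if (k < size w')%N then entry w' k else entry w (k - size w').
Proof. by rewrite /entry rev_cat nth_cat size_rev. Qed.

Lemma eq_word w w' : size w = size w' ->
  (forall k, (k < size w)%N -> entry w k = entry w' k) -> w = w'.
Proof.
move=> e h; apply: (can_inj revK); apply: (@eq_from_nth _ 0).
  by rewrite !size_rev.
by move=> i; rewrite size_rev => /h.
Qed.

Lemma word_act_catl w w' (s : Sinf) : Sn (size w) s ->
  word_act w s ++ w' = word_act (w ++ w') (iter (size w') alpha s).
Proof.
move=> hs; apply: eq_word; rewrite ?size_word_act ?size_cat ?size_word_act //.
move=> k kw; rewrite entry_act ?size_cat // !entry_cat alphaE.
case: (ltnP k (size w')) => kw'; first by rewrite kw'.
by rewrite ltnNge leq_addl /= addnK entry_act // ltn_subLR // addnC.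
Qed.

Lemma word_act_catr w w' (s : Sinf) : Sn (size w') s ->
  w ++ word_act w' s = word_act (w ++ w') s.
Proof.
move=> hs; apply: eq_word; rewrite ?size_word_act ?size_cat ?size_word_act //.
move=> k kw; rewrite entry_act ?size_cat // !entry_cat size_word_act.
case: (ltnP k (size w')) => kw'; first by rewrite Sn_lt // entry_act.
by rewrite hs // ltnNge kw'.
Qed.

Lemma word_del_cat w w' k : (k < size w + size w')%N ->
  word_del (w ++ w') k =
  if (k < size w')%N then w ++ word_del w' k
  else word_del w (k - size w') ++ w'.
Proof.
move=> kw; case: ltnP => kw'; apply: eq_word;
  rewrite ?(size_word_del, size_cat) => *; try lia.
all: rewrite entry_del ?size_cat // !entry_cat ?size_word_del.
  case: ltnP => h1; case: ltnP => h2; rewrite ?entry_del //.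
  - by move: h1 h2; rewrite /bump; lia.
  - by move: h1 h2; rewrite /bump; lia.
  - by congr entry; move: h1 h2; rewrite /bump; lia.
case: ltnP => h1; case: ltnP => h2; rewrite ?entry_del //; try lia.
- by congr entry; move: h1 h2; rewrite /bump; lia.
- by move: h1 h2; rewrite /bump; lia.
- by move: h1 h2; rewrite /bump; lia.
- by congr entry; move: h1 h2; rewrite /bump; lia.
Qed.

Lemma word_del_act w (s : Sinf) k : Sn (size w) s -> (k < size w)%N ->
  exists2 r : Sinf, Sn (size w).-1 r &
    word_act (word_del w (s k)) r = word_del (word_act w s) k /\
    (r * cyc (size w) k = cyc (size w) (s k) * s)%g.
Proof.
move=> hs kw; set p := size w.
have skp : (s k < p)%N by exact: Sn_lt.
exists (cyc p (s k) * s * (cyc p k)^-1)%g; last split; last first.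
- by rewrite -mulgA mulVg mulg1.
- apply: eq_word; rewrite ?(size_word_act, size_word_del) // => j jp.
  rewrite entry_act ?size_word_del // [RHS]entry_del ?size_word_act //.
  have bjp : (bump k j < p)%N by move: jp kw; rewrite /bump /p; lia.
  have e : ((cyc p k)^-1)%g j = bump k j.
    by apply: (@Sinf_inj (cyc p k)); rewrite SinfKV cyc_bump.
  have rj : (cyc p (s k) * s * (cyc p k)^-1)%g j = cyc p (s k) (s (bump k j)).
    by rewrite !SinfME e.
  have bj : bump (s k) ((cyc p (s k) * s * (cyc p k)^-1)%g j) = s (bump k j).
    rewrite rj bump_cyc //; first exact: Sn_lt.
    by move/Sinf_inj/eqP; rewrite eq_sym (negbTE (neq_bump _ _)).
  have sb : (s (bump k j) < p)%N by exact: Sn_lt.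
  have bumpP r m : (m < p)%N -> (bump m r < p)%N -> (r < p.-1)%N.
    by rewrite /bump; case: leqP => /=; lia.
  rewrite [LHS]entry_del; last by apply: (bumpP _ (s k)) => //; rewrite bj.
  by rewrite bj entry_act.
- have rp : Sn p (cyc p (s k) * s * (cyc p k)^-1)%g.
    by do ?apply: SnM => //; try apply: SnV; apply: Sn_cyc.
  move=> j; rewrite leq_eqVlt => /orP[/eqP<-|pj]; last first.
    by apply: rp; move: pj kw; rewrite /p; lia.
  have e : ((cyc p k)^-1)%g p.-1 = k.
    by apply: (@Sinf_inj (cyc p k)); rewrite SinfKV cyc_k.
  by rewrite !SinfME e cyc_k.
Qed.

End Words.

Section TensorSpace.
Context {K : fieldType}.
Variable V : vectType K.

Let Wd : choiceType := (seq V * Sinf)%type.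

(* Generators of the relations presenting the direct sum over p of the        *)
(* V^{(x)p} (x)_{K S_p} K S_infty as a quotient of the free module on the     *)
(* pairs (w, s), with w in V^p for some p and s in S_infty: multilinearity in *)
(* the entries of w, and (w s) (x) t = w (x) (s t) for s in S_p. Each of them *)
(* only involves words of a single length p.                                  *)
Inductive tensor_rel : {malg K[Wd]} -> Prop :=
| TensorLinear a v v' w1 w2 t :
    tensor_rel (<< (w1 ++ (a *: v + v') :: w2, t) : Wd >>
                - (a *: << (w1 ++ v :: w2, t) : Wd >>
                   + << (w1 ++ v' :: w2, t) : Wd >>))
| TensorBalanced w s t : Sn (size w) s ->
    tensor_rel (<< (word_act w s, t) : Wd >> - << (w, (s * t)%g) : Wd >>).

Definition Tbar : Type := {ideal_quot (lspanp tensor_rel)}.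

HB.instance Definition _ := Choice.on Tbar.
HB.instance Definition _ := EqQuotient.on Tbar.
HB.instance Definition _ := GRing.Zmodule.on Tbar.

Definition piT (g : {malg K[Wd]}) : Tbar := \pi_Tbar g.

Lemma piT_eq g h : piT g = piT h <-> lspan tensor_rel (g - h).
Proof.
split=> [/eqP|/asboolP e]; last by apply/eqP; rewrite eqmodE.
by rewrite eqmodE => /asboolP.
Qed.

Lemma piTD g h : piT (g + h) = piT g + piT h.
Proof. by rewrite /piT raddfD. Qed.

Definition Tbar_scale (a : K) (x : Tbar) : Tbar := piT (a *: repr x).

Lemma Tbar_scaleE a g : Tbar_scale a (piT g) = piT (a *: g).
Proof.
apply/piT_eq; rewrite -scalerBr; apply: lspanZ.
by apply/piT_eq; rewrite /piT reprK.
Qed.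

Lemma piT_repr x : piT (repr x) = x. Proof. exact: reprK. Qed.

Lemma Tbar_scaleA a b x : Tbar_scale a (Tbar_scale b x) = Tbar_scale (a * b) x.
Proof. by rewrite -[x]piT_repr !Tbar_scaleE scalerA. Qed.
Lemma Tbar_scale1 : left_id 1 Tbar_scale.
Proof. by move=> x; rewrite -[x]piT_repr !Tbar_scaleE scale1r. Qed.
Lemma Tbar_scaleDr : right_distributive Tbar_scale +%R.
Proof.
move=> a x y; rewrite -[x]piT_repr -[y]piT_repr -piTD !Tbar_scaleE.
by rewrite scalerDr piTD.
Qed.
Lemma Tbar_scaleDl x : {morph Tbar_scale^~ x : a b / a + b}.
Proof.
by move=> a b /=; rewrite -[x]piT_repr !Tbar_scaleE scalerDl piTD.
Qed.

HB.instance Definition _ := GRing.Zmodule_isLmodule.Build K Tbar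
  Tbar_scaleA Tbar_scale1 Tbar_scaleDr Tbar_scaleDl.

Lemma piT_linear : linear piT.
Proof. by move=> a g h; rewrite piTD -Tbar_scaleE. Qed.

HB.instance Definition _ :=
  GRing.isLinear.Build K {malg K[Wd]} Tbar *:%R piT piT_linear.

(* The element w (x) s = v_p .. v_1 s.                                        *)
Definition tens (w : seq V) (s : Sinf) : Tbar := piT << (w, s) : Wd >>.

Lemma tensL a v v' w1 w2 t : tens (w1 ++ (a *: v + v') :: w2) t =
  a *: tens (w1 ++ v :: w2) t + tens (w1 ++ v' :: w2) t.
Proof.
rewrite /tens -linearP; apply/piT_eq; apply: lspan_gen.
exact: TensorLinear.
Qed.

Lemma tens_act w s t : Sn (size w) s ->
  tens (word_act w s) t = tens w (s * t)%g.
Proof. by move=> hs; apply/piT_eq/lspan_gen/TensorBalanced. Qed.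

Lemma Tbar_sum (x : Tbar) : exists (n : nat) (c : 'I_n -> K)
    (k : 'I_n -> Wd), x = \sum_(i < n) c i *: tens (k i).1 (k i).2.
Proof.
pose g := repr x; pose r := enum_fset (msupp g).
exists (size r), (fun i => g@_(tnth (in_tuple r) i)), (tnth (in_tuple r)).
rewrite -[x]piT_repr -/g {1}[g]monalgE linear_sum big_tnth.
apply: eq_bigr => i _; rewrite /tens -linearZ; case: (tnth _ i) => w s /=.
congr piT; apply/malgP => k; rewrite mcoeffZ !mcoeffU.
by rewrite mulrnAr mulr1.
Qed.

Definition balanced (M : lmodType K) (F : seq V -> Sinf -> M) : Prop :=
  (forall a v v' w1 w2 t, F (w1 ++ (a *: v + v') :: w2) t =
     a *: F (w1 ++ v :: w2) t + F (w1 ++ v' :: w2) t) /\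
  (forall w s t, Sn (size w) s -> F (word_act w s) t = F w (s * t)%g).

(* The linear map on the tensor space with prescribed values on the w (x) s;  *)
(* see Tlift_tens and Tlift_linear.                                           *)
Definition Tlift (M : lmodType K) (F : seq V -> Sinf -> M) (x : Tbar) : M :=
  lext (fun k : Wd => F k.1 k.2) (repr x).

Lemma Tlift_pi (M : lmodType K) (F : seq V -> Sinf -> M) g : balanced F ->
  Tlift F (piT g) = lext (fun k : Wd => F k.1 k.2) g.
Proof.
move=> [Flin Fbal]; rewrite /Tlift; apply/eqP; rewrite -subr_eq0 -linearB.
have : lspan tensor_rel (repr (piT g) - g) by apply/piT_eq; rewrite piT_repr.
move=> [n [c [y [hy ->]]]]; rewrite linear_sum big1 // => i _.
rewrite linearZ; case: (hy i) => [a v v' w1 w2 t|w s t hs].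
  by rewrite linearB linearP /= !lextU Flin subrr scaler0.
by rewrite linearB /= !lextU Fbal // subrr scaler0.
Qed.

Lemma Tlift_tens (M : lmodType K) (F : seq V -> Sinf -> M) w s : balanced F ->
  Tlift F (tens w s) = F w s.
Proof. by move=> hF; rewrite /tens Tlift_pi // lextU. Qed.

Lemma Tlift_linear (M : lmodType K) (F : seq V -> Sinf -> M) : balanced F ->
  linear (Tlift F).
Proof.
move=> hF a x y; rewrite -[x]piT_repr -[y]piT_repr -linearP !Tlift_pi //.
by rewrite linearP.
Qed.

Lemma Tbar_ext (M : lmodType K) (f g : Tbar -> M) : linear f -> linear g ->
  (forall w s, f (tens w s) = g (tens w s)) -> f =1 g.
Proof.
move=> flin glin e x; have [n [c [k ->]]] := Tbar_sum x.
pose f' : {linear Tbar -> M} := HB.pack f (GRing.isLinear.Build _ _ _ _ f flin).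
pose g' : {linear Tbar -> M} := HB.pack g (GRing.isLinear.Build _ _ _ _ g glin).
rewrite -[f]/(f' : _ -> _) -[g]/(g' : _ -> _) !linear_sum.
by apply: eq_bigr => i _; rewrite !linearZ /= e.
Qed.

Let mulF w s (w' : seq V) (s' : Sinf) : Tbar :=
  tens (w ++ w') (iter (size w') alpha s * s')%g.

Lemma mulF_balanced w s : balanced (mulF w s).
Proof.
split=> [a v v' w1 w2 t|w' s' t hs]; rewrite /mulF.
  by rewrite !catA tensL !size_cat.
rewrite size_word_act word_act_catr // tens_act; last first.
  by apply: SnW hs; rewrite size_cat leq_addl.
by rewrite !mulgA alphan_comm.
Qed.

Definition tmul (x y : Tbar) : Tbar :=
  Tlift (fun w s => Tlift (fun w' s' =>
    tens (w ++ w') (iter (size w') alpha s * s')%g) y) x.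

Lemma tmul_balanced y : balanced (fun w s => Tlift (mulF w s) y).
Proof.
split=> [a v v' w1 w2 t|w s t hs].
  pose f (b : bool) := mulF (w1 ++ (if b then v else v') :: w2) t.
  apply: (@Tbar_ext _ (Tlift (mulF (w1 ++ (a *: v + v') :: w2) t))
    (fun y => a *: Tlift (f true) y + Tlift (f false) y)) => [||w' s'].
  - exact/Tlift_linear/mulF_balanced.
  - by apply: linear_comb; exact/Tlift_linear/mulF_balanced.
  - rewrite !Tlift_tens; do ?exact: mulF_balanced.
    by rewrite /f /mulF -!catA /= tensL.
apply: (@Tbar_ext _ (Tlift (mulF (word_act w s) t))
  (Tlift (mulF w (s * t)%g))) => [||w' s'].
- exact/Tlift_linear/mulF_balanced.
- exact/Tlift_linear/mulF_balanced.
- rewrite !Tlift_tens; do ?exact: mulF_balanced.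
  rewrite /mulF word_act_catl // tens_act; last first.
    by rewrite size_cat addnC; apply: Sn_alphan.
  by rewrite alphanM mulgA.
Qed.

Lemma tmul_tens w s w' s' : tmul (tens w s) (tens w' s') =
  tens (w ++ w') (iter (size w') alpha s * s')%g.
Proof.
rewrite /tmul Tlift_tens; last exact: tmul_balanced.
by rewrite Tlift_tens //; exact: mulF_balanced.
Qed.

Lemma tmul_linearl y : linear (tmul^~ y).
Proof. exact/Tlift_linear/tmul_balanced. Qed.

Lemma tmul_linearr x : linear (tmul x).
Proof.
move=> a y z; rewrite /tmul.
apply: (@Tbar_ext _ (tmul^~ (a *: y + z))
  (fun x => a *: tmul x y + tmul x z)) => [||w s].
- exact: tmul_linearl.
- by apply: linear_comb; exact: tmul_linearl.
- rewrite /tmul !Tlift_tens; do ?exact: tmul_balanced.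
  exact/Tlift_linear/mulF_balanced.
Qed.

Lemma tmulA : associative tmul.
Proof.
move=> x y z; move: x.
apply: Tbar_ext => [||w s]; first exact: tmul_linearl.
  by move=> a x x'; rewrite !tmul_linearl.
move: y; apply: Tbar_ext => [||w' s'].
- by move=> a y y'; rewrite tmul_linearl tmul_linearr.
- by move=> a y y'; rewrite tmul_linearr tmul_linearl.
move: z; apply: Tbar_ext => [||w'' s''].
- by move=> a z z'; rewrite !tmul_linearr.
- exact: tmul_linearr.
by rewrite !tmul_tens catA size_cat addnC iterD alphanM mulgA.
Qed.

Lemma tmul1 : left_id (tens [::] 1%g) tmul.
Proof.
apply: Tbar_ext => [||w s]; [exact: tmul_linearr|by []|].
by rewrite tmul_tens alphan1 mul1g.
Qed.

Lemma tmul1r : right_id (tens [::] 1%g) tmul.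
Proof.
apply: Tbar_ext => [||w s]; [exact: tmul_linearl|by []|].
by rewrite tmul_tens cats0 mulg1.
Qed.

Lemma tmulDl : left_distributive tmul +%R.
Proof. by move=> x y z; have := tmul_linearl z 1 x y; rewrite !scale1r. Qed.

Lemma tmulDr : right_distributive tmul +%R.
Proof. by move=> x y z; have := tmul_linearr x 1 y z; rewrite !scale1r. Qed.

Lemma tens1_neq0 : tens [::] 1%g != 0.
Proof.
pose F (w : seq V) (s : Sinf) : K^o := (size w == 0)%:R.
have Fb : balanced F.
  split=> [a v v' w1 w2 t|w s t _]; rewrite /F ?size_word_act //.
  by rewrite !size_cat !addnS scaler0 addr0.
have T0 : Tlift F 0 = 0.
  by have := Tlift_linear Fb (-1) 0 0; rewrite scaler0 addr0 scaleN1r addNr.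
apply/eqP => /(congr1 (Tlift F)); rewrite T0 Tlift_tens //.
by apply/eqP; exact: (oner_neq0 K).
Qed.

HB.instance Definition _ := GRing.Zmodule_isNzRing.Build Tbar
  tmulA tmul1 tmul1r tmulDl tmulDr tens1_neq0.

Lemma tmulZl (a : K) (x y : Tbar) : a *: (x * y) = (a *: x) * y.
Proof.
have := tmul_linearl y a x 0; rewrite addr0 -[tmul 0 y]/(0 * y) mul0r addr0.
exact: esym.
Qed.

Lemma tmulZr (a : K) (x y : Tbar) : a *: (x * y) = x * (a *: y).
Proof.
have := tmul_linearr x a y 0; rewrite addr0 -[tmul x 0]/(x * 0) mulr0 addr0.
exact: esym.
Qed.

HB.instance Definition _ := GRing.Lmodule_isLalgebra.Build K Tbar tmulZl.
HB.instance Definition _ := GRing.Lalgebra_isAlgebra.Build K Tbar tmulZr.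

Lemma tensM w s w' s' : tens w s * tens w' s' =
  tens (w ++ w') (iter (size w') alpha s * s')%g.
Proof. exact: tmul_tens. Qed.

End TensorSpace.

Section Operators.
Context {K : fieldType} {V : vectType K}.
Implicit Types (u : V) (s t : Sinf) (f : 'Hom(V, K^o)) (x y : Tbar V).

Definition vec u : Tbar V := tens [:: u] 1%g.
Definition perm_elt s : Tbar V := tens [::] s.

Definition Lmul x : Tbar V -> Tbar V := fun y => x * y.

Let starF f w s : Tbar V :=
  \sum_(k < size w) (f (entry w k) : K) *: tens (word_del w k) (cyc (size w) k * s)%g.

Definition Lstar f : Tbar V -> Tbar V :=
  Tlift (fun w s => \sum_(k < size w)
    (f (entry w k) : K) *: tens (word_del w k) (cyc (size w) k * s)%g).

Lemma starF_balanced f : balanced (starF f).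
Proof.
split=> [a v v' w1 w2 t|w s t hs]; rewrite /starF.
  pose G (z : V) k := (f (entry (w1 ++ z :: w2) k) : K) *:
    tens (word_del (w1 ++ z :: w2) k) (cyc (size w1 + size w2).+1 k * t)%g.
  have GE z : \sum_(k < size (w1 ++ z :: w2)) (f (entry (w1 ++ z :: w2) k) : K) *:
      tens (word_del (w1 ++ z :: w2) k) (cyc (size (w1 ++ z :: w2)) k * t)%g =
      \sum_(0 <= k < (size w1 + size w2).+1) G z k.
    by rewrite [RHS]big_mkord /G size_cat /= addnS.
  rewrite !{}GE scaler_sumr -big_split /= !big_mkord; apply: eq_bigr => k _.
  have kw : (k < size w1 + (size w2).+1)%N by rewrite addnS.
  rewrite {}/G !word_del_cat ?[size (_ :: _)]/= // !entry_cat /=.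
  case: ltnP => h1; last by rewrite tensL scalerDr !scalerA [_ * a]mulrC.
  rewrite -![_ :: w2]cat1s !word_del_cat ?add1n // !entry_cat.
  case: ltnP => h2 /=; first by rewrite tensL scalerDr !scalerA [_ * a]mulrC.
  have -> : (k - size w2 = 0)%N by apply/eqP; rewrite subn_eq0 -ltnS.
  rewrite /word_del /entry /= linearP /=.
  by rewrite scalerDl scalerA.
rewrite size_word_act; pose h (k : 'I_(size w)) := Ordinal (Sn_lt hs (ltn_ord k)).
have h_inj : injective h by move=> i j /(congr1 val) /= /Sinf_inj/val_inj.
rewrite [RHS](reindex_inj h_inj); apply: eq_bigr => k _ /=.
rewrite entry_act //; congr (_ *: _).
have [r hr [e1 e2]] := word_del_act hs (ltn_ord k).
by rewrite -e1 tens_act ?size_word_del // mulgA e2 -mulgA.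
Qed.

Lemma Lstar_tens f w s : Lstar f (tens w s) = \sum_(k < size w)
  (f (entry w k) : K) *: tens (word_del w k) (cyc (size w) k * s)%g.
Proof. exact/Tlift_tens/starF_balanced. Qed.

Lemma Lstar_linear f : linear (Lstar f).
Proof. exact/Tlift_linear/starF_balanced. Qed.

(* L(v_l) .. L(v_1) L(s) L(v*_1) .. L(v*_l), where v = [tuple v_1; ..; v_l]   *)
(* and f = [tuple v*_1; ..; v*_l].                                            *)
Definition Lop l (v : l.-tuple V) s (f : l.-tuple 'Hom(V, K^o)) :
    Tbar V -> Tbar V := fun x =>
  foldl (fun y u => Lmul (vec u) y)
    (Lmul (perm_elt s) (foldr (fun g y => Lstar g y) x f)) v.

Definition Tgen (p n : nat) : set (Tbar V) :=
  [set x | exists w s, [/\ size w = p, Sn n s & x = tens w s]].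

End Operators.

(* T_p^(q)(V) = V^{(x)p} (x)_{K S_p} K S_{p+q}, identified with the subspace  *)
(* of the tensor space spanned by the w (x) s with w in V^p and s in S_{p+q}; *)
(* the identification is injective because K S_infty is a free left module    *)
(* over K S_{p+q}.                                                            *)
Section Tpart.
Context {K : fieldType}.
Variables (V : vectType K) (p q : nat).

Record Tpq := MkTpq {
  tpq_val :> Tbar V; _ : tpq_val \in lspanp (@Tgen K V p (p + q)) }.

HB.instance Definition _ := [isSub for tpq_val].
HB.instance Definition _ := [Choice of Tpq by <:].
HB.instance Definition _ := [SubChoice_isSubLmodule of Tpq by <:].

(* The spanning operators exist for all v, s, f: see Lop_Tpq and Rperm_Tpq.   *)
Definition Lset (l : nat) : set (Tpq -> Tpq) :=
  lspan [set D | exists (v : l.-tuple V) (s : Sinf)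
                   (f : l.-tuple 'Hom(V, K^o)),
    Sn (l + q) s /\ forall x, \val (D x) = Lop v s f (\val x)].

Definition Rset : set (Tpq -> Tpq) :=
  lspan [set D | exists2 s : Sinf, Sn (p + q) s &
    forall x, \val (D x) = \val x * perm_elt s].

End Tpart.

Arguments Lset {K} V p q l.
Arguments Rset {K} V p q.

Definition commutant (K : fieldType) (U : lmodType K) (S : set (U -> U)) :
    set (U -> U) :=
  [set D | linear D /\ forall E, S E -> D \o E = E \o D].

Section Stability.
Context {K : fieldType} {V : vectType K}.
Implicit Types (s : Sinf) (f : 'Hom(V, K^o)) (x : Tbar V).

Lemma Lstar_stable f p n x : (p <= n)%N ->
  lspan (Tgen p n) x -> lspan (Tgen p.-1 n) (Lstar f x).
Proof.
move=> pn; apply: lspan_img; first exact: Lstar_linear.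
move=> _ [w [s [wp hs ->]]]; rewrite Lstar_tens; apply: lspan_sum => k _.
apply/lspanZ/lspan_gen; exists (word_del w k), (cyc (size w) k * s)%g.
split; rewrite ?size_word_del ?wp //; apply: SnM => //.
by apply: SnW (@Sn_cyc _ _); rewrite wp.
Qed.

Lemma Lstar_deg0 f n x : lspan (Tgen 0 n) x -> Lstar f x = 0.
Proof.
have h y : Tgen 0 n y -> lspan (set0 : set (Tbar V)) (Lstar f y).
  move=> [w [s [/size0nil -> _ ->]]].
  by rewrite Lstar_tens big_ord0; apply: lspan0.
move=> /(lspan_img (@Lstar_linear K V f) h) [m [c [y [hy ->]]]].
by apply: big1 => i; case: (hy i).
Qed.

Lemma Lstars_stable (fs : seq 'Hom(V, K^o)) p n x : (p <= n)%N ->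
  lspan (Tgen p n) x ->
  lspan (Tgen (p - size fs) n) (foldr (fun g y => Lstar g y) x fs).
Proof.
move=> pn hx; elim: fs => [|f fs IH] /=; first by rewrite subn0.
by rewrite subnS; apply: Lstar_stable IH; rewrite (leq_trans (leq_subr _ _)).
Qed.

Lemma Lstars_eq0 (fs : seq 'Hom(V, K^o)) p n x : (p <= n)%N ->
  (p < size fs)%N -> lspan (Tgen p n) x ->
  foldr (fun g y => Lstar g y) x fs = 0.
Proof.
move=> pn; case: fs => //= f fs ps hx; apply: (@Lstar_deg0 _ n).
by have := Lstars_stable fs pn hx; have -> : (p - size fs = 0)%N by lia.
Qed.

Lemma Lperm_stable s m p n x : Sn m s -> (p + m <= n)%N ->
  lspan (Tgen p n) x -> lspan (Tgen p n) (perm_elt s * x).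
Proof.
move=> hs mn; apply: (lspan_img (f := Lmul (perm_elt s))).
  exact: tmul_linearr.
move=> _ [w [t [wp ht ->]]]; apply: lspan_gen.
exists w, (iter p alpha s * t)%g; split=> //; last by rewrite /Lmul tensM wp.
by apply: SnM ht; apply: SnW mn _; apply: Sn_alphan.
Qed.

Lemma Lvec_stable (u : V) p n x :
  lspan (Tgen p n) x -> lspan (Tgen p.+1 n) (vec u * x).
Proof.
apply: (lspan_img (f := Lmul (vec u))); first exact: tmul_linearr.
move=> _ [w [t [wp ht ->]]]; apply: lspan_gen; exists (u :: w), t.
by split; rewrite /= ?wp // /Lmul tensM alphan1 mul1g.
Qed.

Lemma Lop_stable l (v : l.-tuple V) s (f : l.-tuple 'Hom(V, K^o)) p q x :
  Sn (l + q) s -> lspan (Tgen p (p + q)) x ->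
  lspan (Tgen p (p + q)) (Lop v s f x).
Proof.
move=> hs hx; rewrite /Lop.
have [lp|pl] := leqP l p; last first.
  rewrite (Lstars_eq0 (leq_addr q p)) ?size_tuple // /Lmul mulr0.
  elim: (tval v) => [|u us IH] /=; first exact: lspan0.
  by rewrite mulr0.
have := Lstars_stable f (leq_addr q p) hx; rewrite size_tuple.
move=> /(Lperm_stable hs); rewrite addnA subnK // => /(_ (leqnn _)).
rewrite -/(Lmul _ _); move: (Lmul _ _) => y.
rewrite -[l in (p - l)%N](size_tuple v).
have : (size v <= p)%N by rewrite size_tuple.
elim: (tval v) y => [|u us IH] y /= up; first by rewrite subn0.
move=> hy; apply: IH; first by rewrite ltnW.
by rewrite -(subnSK up); apply: Lvec_stable.
Qed.

Lemma Lop_Tpq l (v : l.-tuple V) s (f : l.-tuple 'Hom(V, K^o)) p q :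
  Sn (l + q) s -> exists D : Tpq V p q -> Tpq V p q,
    forall x : Tpq V p q, \val (D x) = Lop v s f (\val x).
Proof.
move=> hs; have h (x : Tpq V p q) : Lop v s f (\val x) \in
    lspanp (@Tgen K V p (p + q)).
  by apply/asboolP/Lop_stable => //; apply/asboolP; case: x.
by exists (fun x : Tpq V p q => MkTpq (h x)).
Qed.

Lemma Rperm_Tpq s p q : Sn (p + q) s -> exists D : Tpq V p q -> Tpq V p q,
  forall x : Tpq V p q, \val (D x) = \val x * perm_elt s.
Proof.
move=> hs; have h (x : Tpq V p q) : \val x * perm_elt s \in
    lspanp (@Tgen K V p (p + q)).
  apply/asboolP; apply: (lspan_img (f := fun y => y * perm_elt s)
    (S := Tgen p (p + q))).
  - exact: tmul_linearl.
  - move=> _ [w [t [wp ht ->]]]; apply: lspan_gen; exists w, (t * s)%g.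
    by split=> //; [exact: SnM|rewrite tensM cats0].
  - by apply/asboolP; case: x.
by exists (fun x : Tpq V p q => MkTpq (h x)).
Qed.

End Stability.

(* Main.v *)
From HB Require Import structures.
Require Import Defs.
From mathcomp Require Import all_boot all_order all_algebra all_fingroup.
From mathcomp Require Import boolp classical_sets functions reals complex zify.

Set Implicit Arguments.
Unset Strict Implicit.
Unset Printing Implicit Defensive.
Import GRing.Theory.
Local Open Scope ring_scope.
Local Open Scope classical_set_scope.

(** Write n = p + q, A = K S_n, T = T_p^(q), and for p linear forms
    f = (f_1, .., f_p) let phi_f = L(f_1) .. L(f_p), which maps T to A.  All
    the phi_f are right A-linear, since L of a linear form commutes with right
    multiplication by permutations.

    The chain of inclusions comes from an Euler identity: for dual bases e_i,
    e_i' of V, the operator sum_i L(e_i) L(e_i') is multiplication by m on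
    tensors of degree m ([euler]), because inserting v_k back in front of the
    tensor from which it was removed is undone by the cycle that L(e_i')
    inserts.  After l contractions the degree is m = p - l, so for l < p one
    more pair of operators can be inserted at the cost of the factor 1/(p - l).
    For l > p some contraction acts in degree 0, and the operators vanish.

    Since the identity is in L_0, it is in L_p ([Lset_id]): there are t_j in T
    and f_j with z = sum_j t_j phi_(f_j)(z) for all z in T.  This is a finite
    dual basis of the right A-module T, with dual vectors phi_(f_j).  Hence,
    if D commutes with A, D z = sum_j D(t_j) phi_(f_j)(z), and each operator
    z |-> t phi_f(z) with t in T is in L_p ([commutant_Rset_sub]).

    For the other commutant, let J be the left ideal of A generated by the
    values of all the phi_f.  By Maschke's theorem J = A a for some a in J with
    y a = y on J ([left_ideal_right_unit]); the dual basis then gives z a = z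
    on T.  Write a = sum_j c_j s_j phi_(f_j)(x_j), so that
    z = sum_j c_j G_j(x_j) where G_j(x) = z s_j phi_(f_j)(x) is in L_p.  If D
    commutes with L_p then D z = sum_j c_j G_j(D x_j) = z b, with
    b = sum_j c_j s_j phi_(f_j)(D x_j) independent of z, so D is right
    multiplication by b ([commutant_Lset_sub]). *)

(** * Left ideals of a group algebra *)

(** A subspace contained in Q and of maximal dimension among these is all of
    Q. *)
Lemma vspace_of_submod (K : fieldType) (vT : vectType K) (Q : {pred vT}) :
  submod_closed Q -> exists U : {vspace vT}, forall v, (v \in U) = (v \in Q).
Proof.
case=> Q0 Qlin.
pose P d := `[< exists2 U : {vspace vT}, \dim U = d & {subset U <= Q} >].
have exP : exists d, P d.
  exists 0%N; apply/asboolP; exists 0%VS; first exact: dimv0.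
  by move=> v; rewrite memv0 => /eqP->.
have leP d : P d -> (d <= \dim {:vT})%N.
  by move=> /asboolP[U <- _]; apply/dimvS/subvf.
case: (ex_maxnP exP leP) => d /asboolP[U dU UQ] dmax.
exists U => v; apply/idP/idP => [/UQ //|Qv].
have /dmax : P (\dim (U + <[v]>)).
  apply/asboolP; exists (U + <[v]>)%VS => // w.
  move=> /memv_addP[u Uu [z vz ->]]; have /vlineP[a ->] := vz.
  by rewrite addrC; apply: Qlin => //; apply: UQ.
rewrite -dU => le.
have /eqP-> : U == (U + <[v]>)%VS by rewrite eqEdim addvSl le.
exact: (subvP (addvSr _ _)) (memv_line v).
Qed.

(** Maschke's theorem for a left ideal J of the image of a group algebra in A:
    averaging a linear projection onto J over the group makes it left linear,
    and then it is right multiplication by the image of 1, which is the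
    witness. *)
Lemma left_ideal_right_unit (K : fieldType) (A : algType K)
    (gT : finGroupType) (rho : gT -> A) (J : {pred A}) :
  #|gT|%:R != 0 :> K -> rho 1%g = 1 ->
  (forall s t, rho (s * t)%g = rho s * rho t) -> submod_closed J ->
  (forall s y, y \in J -> rho s * y \in J) ->
  {in J, forall y, exists c : gT -> K, y = \sum_s c s *: rho s} ->
  exists2 e, e \in J & {in J, forall y, y * e = y}.
Proof.
move=> G0 rho1 rhoM Jsub Jrho Jspan.
(* The projection is taken in the free space on gT, onto the preimage of J
   under iota, since A need not be finite-dimensional. *)
pose iota (c : {ffun gT -> K^o}) : A := \sum_s (c s : K) *: rho s.
have iota_lin : linear iota.
  move=> a c d; rewrite /iota scaler_sumr -big_split; apply: eq_bigr => s _ /=.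
  by rewrite !ffunE scalerDl scalerA.
pose il : {linear _ -> _} :=
  HB.pack iota (GRing.isLinear.Build _ _ _ _ iota iota_lin).
have [J0 Jlin] := Jsub.
have [|U UE] := @vspace_of_submod _ _ [pred c | iota c \in J].
  split=> [|a c d]; rewrite !inE; first by rewrite (raddf0 il : iota 0 = 0).
  by move=> *; rewrite iota_lin Jlin.
have PU c : c \in U -> projv U c = c by move=> cU; rewrite projv_id.
pose P := projv U.
have JP c : iota (P c) \in J by have := memv_proj U c; rewrite UE.
pose del (s : gT) : {ffun gT -> K^o} := [ffun t => (t == s)%:R].
have Jsum (F : gT -> A) : (forall s, F s \in J) -> \sum_s F s \in J.
  move=> JF; apply: (big_ind (fun x => x \in J)) => // x y Jx Jy.
  by have := Jlin 1 x y Jx Jy; rewrite scale1r.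
(* The value at 1 of the average of y |-> g P(g^-1 y). *)
exists (#|gT|%:R^-1 *: \sum_g rho g * iota (P (del g^-1%g))).
  rewrite -[_ *: _]addr0; apply: (Jlin _ _ 0) => //.
  by apply: Jsum => s; apply: Jrho.
move=> y Jy; have [c yE] := Jspan y Jy.
rewrite -scalerAr mulr_sumr.
pose lam h : {ffun gT -> K^o} := \sum_s c s *: del (h^-1 * s)%g.
have iota_del s : iota (del s) = rho s.
  rewrite /iota (bigD1 s) //= ffunE eqxx scale1r big1 ?addr0 // => t ts.
  by rewrite ffunE (negbTE ts) scale0r.
have lamE h : iota (lam h) = rho h^-1%g * y.
  rewrite -[iota]/(il : _ -> _) linear_sum yE mulr_sumr; apply: eq_bigr => s _.
  by rewrite linearZ /= iota_del rhoM scalerAr.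
have lamU h : P (lam h) = lam h by apply: PU; rewrite UE inE lamE Jrho.
have key : \sum_g y * (rho g * iota (P (del g^-1%g))) =
           \sum_h rho h * iota (P (lam h)).
  under eq_bigr do rewrite {1}yE mulr_suml.
  under [RHS]eq_bigr => h _.
    rewrite linear_sum -[iota]/(il : _ -> _) linear_sum mulr_sumr; over.
  rewrite exchange_big [RHS]exchange_big /=; apply: eq_bigr => s _.
  rewrite [RHS](reindex_inj (mulgI s)) /=; apply: eq_bigr => g _.
  rewrite invMg mulgKV linearZ /= -[iota]/(il : _ -> _) linearZ /=.
  by rewrite rhoM -scalerAl -scalerAr mulrA.
rewrite key (eq_bigr (fun=> y)) => [|h _]; last first.
  by rewrite lamU lamE mulrA -rhoM mulgV rho1 mul1r.
by rewrite sumr_const -scaler_nat scalerA mulVf // scale1r.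
Qed.

(** * Commutation of spans of operators *)

Section SpansOfOperators.
Context {K : fieldType} {U : lmodType K}.
Implicit Types (S : set (U -> U)) (D E : U -> U).

Lemma lspan_linear S : (forall D, S D -> linear D) ->
  forall D, lspan S D -> linear D.
Proof.
move=> Slin _ [N [c [D [hD ->]]]] a x y.
rewrite !fct_sumE scaler_sumr -big_split; apply: eq_bigr => j _ /=.
by rewrite !scalrfctE (Slin _ (hD j)) scalerDr !scalerA mulrC.
Qed.

Lemma lspan_commute S E : linear E ->
  (forall D, S D -> D \o E = E \o D) -> forall D, lspan S D -> D \o E = E \o D.
Proof.
move=> Elin comm _ [N [c [D [hD ->]]]].
pose El : {linear U -> U} := HB.pack E (GRing.isLinear.Build _ _ _ _ _ Elin).
apply: funext => x /=; rewrite !fct_sumE -[RHS]/(El _) linear_sum.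
apply: eq_bigr => j _; rewrite !scalrfctE linearZ /=; congr (_ *: _).
exact: (congr1 (fun F : U -> U => F x) (comm _ (hD j))).
Qed.

Lemma lspan_sub_commutant S S' : (forall D, S D -> linear D) ->
  (forall E, S' E -> linear E) ->
  (forall D E, S D -> S' E -> D \o E = E \o D) ->
  lspan S `<=` commutant (lspan S').
Proof.
move=> Slin S'lin comm D hD; have Dlin := lspan_linear Slin hD.
split=> // E hE; apply/esym; apply: (lspan_commute Dlin _ hE) => E0 hE0.
by apply/esym; apply: (lspan_commute (S'lin _ hE0) _ hD) => D0 /comm; exact.
Qed.

End SpansOfOperators.

(** * The finite symmetric groups inside the infinite one *)

Section FinitePermutations.
Variable n : nat.
Implicit Types s t : 'S_n.

Definition perm_fun s (k : nat) : nat :=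
  oapp (fun i : 'I_n => val (s i)) k (insub k).

Lemma perm_fun_ord s (i : 'I_n) : perm_fun s i = s i.
Proof. by rewrite /perm_fun valK. Qed.

Lemma perm_fun_out s k : (n <= k)%N -> perm_fun s k = k.
Proof. by move=> nk; rewrite /perm_fun insubF // ltnNge nk. Qed.

Lemma perm_funM s t k : perm_fun (s * t)%g k = perm_fun t (perm_fun s k).
Proof.
case: (ltnP k n) => [kn|nk]; last by rewrite !perm_fun_out.
by rewrite -[k]/(val (Ordinal kn)) !perm_fun_ord permM.
Qed.

Lemma perm_fun1 k : perm_fun 1%g k = k.
Proof.
case: (ltnP k n) => [kn|nk]; last by rewrite perm_fun_out.
by rewrite -[k]/(val (Ordinal kn)) perm_fun_ord perm1.
Qed.

Lemma perm_fun_subproof s : finperm_pred (perm_fun s^-1%g).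
Proof.
apply: (@finperm_predI _ (perm_fun s) n) => [k|k|]; last exact: perm_fun_out.
- by rewrite -perm_funM mulVg perm_fun1.
- by rewrite -perm_funM mulgV perm_fun1.
Qed.

(** The inverse turns the product of {perm T}, which applies the left factor
    first, into composition, so that this is a group morphism. *)
Definition Sinf_of_perm s : Sinf := MkSinf (perm_fun_subproof s).

Lemma Sinf_of_perm1 : Sinf_of_perm 1%g = 1%g.
Proof. by apply: SinfP => k; rewrite /= invg1 perm_fun1. Qed.

Lemma Sinf_of_permM s t :
  Sinf_of_perm (s * t)%g = (Sinf_of_perm s * Sinf_of_perm t)%g.
Proof. by apply: SinfP => k; rewrite SinfME /= invMg perm_funM. Qed.

Lemma Sn_Sinf_of_perm s : Sn n (Sinf_of_perm s).
Proof. by move=> k nk; exact: perm_fun_out. Qed.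

Lemma Sinf_of_perm_surj (r : Sinf) : Sn n r -> exists s, Sinf_of_perm s = r.
Proof.
move=> hr; pose f (i : 'I_n) := Ordinal (Sn_lt hr (ltn_ord i)).
have f_inj : injective f by move=> i j /(congr1 val) /= /Sinf_inj/val_inj.
exists (perm f_inj)^-1%g; apply: SinfP => k; rewrite /= invgK.
case: (ltnP k n) => [kn|nk]; last by rewrite perm_fun_out // hr.
by rewrite -[k]/(val (Ordinal kn)) perm_fun_ord permE.
Qed.

End FinitePermutations.

(** * The Euler identity *)

Notation Lstars fs x := (foldr (fun g y => Lstar g y) x fs).

HB.instance Definition _ (K : fieldType) (V : vectType K) (f : 'Hom(V, K^o)) :=
  GRing.isLinear.Build K (Tbar V) (Tbar V) *:%R (Lstar f) (Lstar_linear f).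

Section LeftOperators.
Context {K : fieldType} {V : vectType K}.
Implicit Types (s t : Sinf) (w : seq V) (x y : Tbar V).

Lemma perm_elt1 : perm_elt 1%g = 1 :> Tbar V. Proof. by []. Qed.

Lemma perm_eltM s t : perm_elt (s * t)%g = perm_elt s * perm_elt t :> Tbar V.
Proof. by rewrite /perm_elt tensM. Qed.

Lemma tens_perm w s t : tens w s * perm_elt t = tens w (s * t)%g.
Proof. by rewrite tensM cats0. Qed.

Lemma Lstar_mul_perm f x t : Lstar f (x * perm_elt t) = Lstar f x * perm_elt t.
Proof.
apply: (@Tbar_ext _ _ _ (fun x => Lstar f (x * perm_elt t))
  (fun x => Lstar f x * perm_elt t)) => [a y z|a y z|w s].
- by rewrite mulrDl -scalerAl linearP.
- by rewrite linearP mulrDl -scalerAl.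
rewrite tens_perm !Lstar_tens mulr_suml; apply: eq_bigr => k _.
by rewrite -scalerAl tens_perm mulgA.
Qed.

Lemma Lstars_mul_perm (fs : seq 'Hom(V, K^o)) x t :
  Lstars fs (x * perm_elt t) = Lstars fs x * perm_elt t.
Proof. by elim: fs => [//|f fs IH]; rewrite /= IH; exact: Lstar_mul_perm. Qed.

Lemma Lstars_linear (fs : seq 'Hom(V, K^o)) : linear (fun x => Lstars fs x).
Proof. by elim: fs => //= f fs IH a x y; rewrite IH linearP. Qed.

Lemma Lop_tens l (v : l.-tuple V) s (f : l.-tuple 'Hom(V, K^o)) x :
  Lop v s f x = tens (rev v) s * Lstars f x.
Proof.
have foldE us y :
    foldl (fun y u => Lmul (vec u) y) y us = tens (rev us) 1%g * y.
  elim: us y => [|u us IH] y /=; first by rewrite [tens _ _]perm_elt1 mul1r.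
  rewrite IH /Lmul mulrA /vec tensM alphan1 mul1g.
  by rewrite rev_cons -cats1.
rewrite /Lop foldE /Lmul mulrA; congr (_ * _).
by rewrite tens_perm mul1g.
Qed.

Lemma Lop_linear l (v : l.-tuple V) s (f : l.-tuple 'Hom(V, K^o)) :
  linear (Lop v s f).
Proof.
by move=> a x y; rewrite !Lop_tens Lstars_linear mulrDr scalerAr.
Qed.

Let e (i : 'I_(\dim {:V})) : V := (vbasis {:V})`_i.
Let estar (i : 'I_(\dim {:V})) : 'Hom(V, K^o) :=
  linfun (coord (vbasis {:V}) i : V -> K^o).

(** For m = size w the inverse cycle sends the position m - 1 to k and each
    j < m - 1 to bump k j, the position from which word_del reads. *)
Lemma word_act_cycV w (k : 'I_(size w)) :
  word_act w (cyc (size w) k)^-1%g = entry w k :: word_del w k.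
Proof.
have sz : (0 < size w)%N by case: k => m; lia.
apply: eq_word; rewrite ?size_word_act /= ?size_word_del ?prednK // => j jw.
rewrite entry_act //.
rewrite -cat1s entry_cat size_word_del.
have cE i : cyc (size w) k i = j -> (cyc (size w) k)^-1%g j = i.
  by move=> <-; rewrite SinfVK.
case: ltnP => h.
  by rewrite entry_del //; congr entry; apply: cE; rewrite cyc_bump.
have jE : j = (size w).-1 by lia.
rewrite jE subnn; transitivity (entry w k) => //.
by congr entry; rewrite -jE; apply: cE; rewrite cyc_k.
Qed.

Lemma sum_tens_cons w s (u : V) :
  \sum_i (estar i u : K) *: tens (e i :: w) s = tens (u :: w) s.
Proof.
pose F (z : V) := tens (z :: w) s.
have Flin : linear F by move=> a y z; exact: (tensL a y z [::]).
pose Fl : {linear V -> Tbar V} :=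
  HB.pack F (GRing.isLinear.Build _ _ _ _ F Flin).
rewrite -[RHS]/(Fl u) {2}(coord_vbasis (memvf u)) linear_sum.
by apply: eq_bigr => i _; rewrite linearZ /= lfunE.
Qed.

(** On the tensor w s, the sum over i restores the k-th entry of w in front of
    word_del w k, by duality of the bases; by [word_act_cycV] the word so
    obtained is w acted on by the inverse of the cycle in Lstar, so each of the
    m entries contributes w s. *)
Lemma euler m n x : lspan (Tgen m n) x ->
  \sum_i vec (e i) * Lstar (estar i) x = m%:R *: x.
Proof.
move=> [N [c [y [hy ->]]]].
have key j : \sum_i vec (e i) * Lstar (estar i) (y j) = m%:R *: y j.
  have [w [s [<- _ ->]]] := hy j.
  under eq_bigr do rewrite Lstar_tens mulr_sumr.
  rewrite exchange_big /= (eq_bigr (fun=> tens w s)) => [|k _].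
    by rewrite sumr_const card_ord scaler_nat.
  under eq_bigr do rewrite -scalerAr tensM alphan1 mul1g.
  rewrite sum_tens_cons -word_act_cycV tens_act ?mulgA ?mulVg ?mul1g //.
  exact/SnV/Sn_cyc.
under eq_bigr do rewrite linear_sum mulr_sumr.
rewrite exchange_big scaler_sumr; apply: eq_bigr => j _ /=.
rewrite scalerA mulrC -scalerA -key scaler_sumr; apply: eq_bigr => i _.
by rewrite linearZ scalerAr.
Qed.

(** * The filtration by the number of contractions *)

Section Tpq_operators.
Variables p q : nat.
Local Notation T := (Tpq V p q).
Implicit Types (z : T) (D : T -> T).

Lemma TpqP z : lspan (Tgen p (p + q)) (\val z).
Proof. by apply/asboolP; case: z. Qed.

Lemma val_sumZ N (c : 'I_N -> K) (z : 'I_N -> T) :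
  \val (\sum_j c j *: z j) = \sum_j c j *: \val (z j).
Proof.
rewrite (raddf_sum (\val : {additive T -> Tbar V})); apply: eq_bigr => j _.
exact: (linearZZ (\val : {linear T -> Tbar V})).
Qed.

Lemma sum_scale_fun N (c : 'I_N -> K) (D : 'I_N -> T -> T) z :
  (\sum_j c j *: D j) z = \sum_j c j *: D j z.
Proof. by rewrite fct_sumE. Qed.

Lemma val_sum_scale N (c : 'I_N -> K) (D : 'I_N -> T -> T) z :
  \val ((\sum_j c j *: D j) z) = \sum_j c j *: \val (D j z).
Proof. by rewrite sum_scale_fun val_sumZ. Qed.

Lemma Tpq_of x : lspan (Tgen p (p + q)) x -> exists z : T, \val z = x.
Proof. by move=> /asboolP hx; exists (MkTpq hx). Qed.

(** A tensor w s of degree p is v_p .. v_1 s with v the reversal of w, so that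
    left multiplication by it after p contractions is a spanning operator. *)
Lemma Lset_tens x (f : p.-tuple 'Hom(V, K^o)) : lspan (Tgen p (p + q)) x ->
  exists2 D, Lset V p q p D & forall z, \val (D z) = x * Lstars f (\val z).
Proof.
move=> [N [c [y [hy ->]]]].
have /choice[D DE] j : exists D, Lset V p q p D /\
    forall z, \val (D z) = y j * Lstars f (\val z).
  have [w [s [wp hs yE]]] := hy j.
  have wp' : size (rev w) == p by rewrite size_rev wp.
  have [D DE] := @Lop_Tpq K V p (Tuple wp') s f p q hs.
  exists D; split; last by move=> z; rewrite DE Lop_tens revK yE.
  by apply: lspan_gen; exists (Tuple wp'), s, f.
exists (\sum_j c j *: D j).
  by apply: lspan_sum => j _; apply/lspanZ; case: (DE j).
move=> z; rewrite val_sum_scale mulr_suml; apply: eq_bigr => j _.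
by rewrite -scalerAl -(DE j).2.
Qed.

Lemma Lset_gen_linear l (v : l.-tuple V) s (f : l.-tuple 'Hom(V, K^o)) D :
  (forall z, \val (D z) = Lop v s f (\val z)) -> linear D.
Proof.
by move=> DE a x y; apply: val_inj; rewrite linearP /= !DE linearP Lop_linear.
Qed.

Lemma Rset_gen_linear s D :
  (forall z, \val (D z) = \val z * perm_elt s) -> linear D.
Proof.
move=> DE a x y; apply: val_inj.
by rewrite linearP /= !DE linearP mulrDl scalerAl.
Qed.

Lemma Lset_zero l : (p < l)%N -> Lset V p q l = [set 0].
Proof.
move=> pl; apply/seteqP; split=> [D [N [c [E [hE ->]]]]|D /= ->]; last first.
  exact: lspan0.
rewrite /= big1 // => j _; have [v [s [f [_ DE]]]] := hE j.
suff -> : E j = 0 by rewrite scaler0.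
apply: funext => z; apply: val_inj; rewrite DE Lop_tens.
by rewrite (Lstars_eq0 (leq_addr q p) _ (TpqP z)) ?size_tuple // mulr0.
Qed.

(** Contractions lower the degree from p to p - l, where the Euler identity
    expresses the identity by the e_i; L(s) L(e_i) = L(e_i) L(alpha s) then
    moves the new vector to the left of the permutation. *)
Lemma Lset_succ l : (p - l)%:R != 0 :> K -> (l < p)%N ->
  Lset V p q l `<=` Lset V p q l.+1.
Proof.
move=> pl0 lp.
apply: (lspan_img (f := id)) => [a x y //|D [v [s [f [hs DE]]]]].
have /choice[E EE] i : exists E : T -> T, forall z, \val (E z) =
    Lop [tuple of e i :: v] (alpha s) [tuple of estar i :: f] (\val z).
  by apply: Lop_Tpq; exact: Sn_alpha.
have -> : D = \sum_i (p - l)%:R^-1 *: E i.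
  apply: funext => z; apply: val_inj; rewrite val_sum_scale DE Lop_tens.
  have /euler yE := Lstars_stable f (leq_addr q p) (TpqP z).
  rewrite size_tuple in yE.
  rewrite -[Lstars f _](scalerK pl0) -yE.
  rewrite scaler_sumr mulr_sumr; apply: eq_bigr => i _.
  rewrite -scalerAr; congr (_ *: _).
  by rewrite [RHS](EE i z) [RHS]Lop_tens mulrA
    /vec tensM mulg1 /= rev_cons cats1.
apply: lspan_sum => i _; apply/lspanZ/lspan_gen.
exists [tuple of e i :: v], (alpha s), [tuple of estar i :: f].
by split; [exact: Sn_alpha|exact: EE].
Qed.

Lemma Lset_id : p`!%:R != 0 :> K -> Lset V p q p id.
Proof.
move=> p0; suff h l : (l <= p)%N -> Lset V p q l id by exact: h.
elim: l => [_|l IH lp].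
  apply: lspan_gen; exists [tuple], 1%g, [tuple]; split=> // z.
  by rewrite Lop_tens [tens _ _]perm_elt1 mul1r.
apply: Lset_succ => //; last exact/IH/ltnW.
apply: contraNneq p0 => p0.
have /dvdnP[m ->] : (p - l %| p`!)%N by apply: dvdn_fact; lia.
by rewrite natrM p0 mulr0.
Qed.

End Tpq_operators.
End LeftOperators.

(** * The two commutants *)

Section Commutants.
Context {K : fieldType} {V : vectType K}.
Variables p q : nat.
Local Notation n := (p + q)%N.
Local Notation T := (Tpq V p q).
Implicit Types (z : T) (D : T -> T).

Lemma Lset_Rset_commute D E :
  (exists (v : p.-tuple V) (s : Sinf) (f : p.-tuple 'Hom(V, K^o)),
     Sn n s /\ forall z, \val (D z) = Lop v s f (\val z)) ->
  (exists2 s : Sinf, Sn n s & forall z, \val (E z) = \val z * perm_elt s) ->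
  D \o E = E \o D.
Proof.
move=> [v [s [f [_ DE]]]] [t _ EE]; apply: funext => z; apply: val_inj => /=.
by rewrite (DE (E z)) (EE (D z)) EE DE !Lop_tens Lstars_mul_perm mulrA.
Qed.

Lemma Lset_sub_commutant : Lset V p q p `<=` commutant (Rset V p q).
Proof.
apply: lspan_sub_commutant => [D [v [s [f [_ DE]]]]|E [s _ EE]|D E].
- exact: Lset_gen_linear DE.
- exact: Rset_gen_linear EE.
- exact: Lset_Rset_commute.
Qed.

Lemma Rset_sub_commutant : Rset V p q `<=` commutant (Lset V p q p).
Proof.
apply: lspan_sub_commutant => [E [s _ EE]|D [v [s [f [_ DE]]]]|E D hE hD].
- exact: Rset_gen_linear EE.
- exact: Lset_gen_linear DE.
- by apply/esym; exact: Lset_Rset_commute.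
Qed.

Lemma lspan_Tgen0 (a : Tbar V) : lspan (Tgen 0 n) a ->
  exists N (c : 'I_N -> K) (s : 'I_N -> Sinf),
    (forall j, Sn n (s j)) /\ a = \sum_j c j *: perm_elt (s j).
Proof.
move=> [N [c [y [hy ->]]]].
have /choice[s sE] j : exists s, Sn n s /\ y j = perm_elt s.
  by have [w [s [/size0nil -> hs ->]]] := hy j; exists s.
exists N, c, s; split=> [j|]; first by case: (sE j).
by apply: eq_bigr => j _; rewrite -(sE j).2.
Qed.

Lemma Rset_mul a : lspan (Tgen 0 n) a ->
  exists2 E : T -> T, Rset V p q E & forall z, \val (E z) = \val z * a.
Proof.
move=> /lspan_Tgen0[N [c [s [hs ->]]]].
have /choice[E EE] j := @Rperm_Tpq K V (s j) p q (hs j).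
exists (\sum_j c j *: E j).
  by apply: lspan_sum => j _; apply/lspanZ/lspan_gen; exists (s j).
move=> z; rewrite val_sum_scale mulr_sumr; apply: eq_bigr => j _.
by rewrite EE scalerAr.
Qed.

Lemma commutant_Rset_mul D z z' a : commutant (Rset V p q) D ->
  lspan (Tgen 0 n) a -> \val z' = \val z * a -> \val (D z') = \val (D z) * a.
Proof.
move=> [_ Dcomm] /Rset_mul[E hE EE] z'E.
have -> : z' = E z by apply: val_inj; rewrite EE.
by rewrite -EE -[D (E z)]/((D \o E) z) Dcomm.
Qed.

Lemma Lstars_deg0 (f : p.-tuple 'Hom(V, K^o)) z :
  lspan (Tgen 0 n) (Lstars f (\val z)).
Proof.
by have := Lstars_stable f (leq_addr q p) (TpqP z); rewrite size_tuple subnn.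
Qed.

(** The expansion of the identity in L_p is a dual basis of T over the group
    algebra; an operator that commutes with the latter is determined by its
    values on the basis. *)
Lemma commutant_Rset_sub : p`!%:R != 0 :> K ->
  commutant (Rset V p q) `<=` Lset V p q p.
Proof.
move=> p0 D hD; have [Dlin _] := hD.
have [N [c [E [hE idE]]]] := @Lset_id K V p q p0.
have /choice[G GE] j : exists G, Lset V p q p G /\ forall z, D (E j z) = G z.
  have [v [s [f [hs EE]]]] := hE j.
  have [|t tE] := @Tpq_of K V p q (tens (rev v) s).
    by apply: lspan_gen; exists (rev v), s; rewrite size_rev size_tuple.
  have [G hG GE] := Lset_tens f (TpqP (D t)).
  exists G; split; first exact: hG.
  move=> z; apply: val_inj; rewrite GE.
  apply: (commutant_Rset_mul hD (Lstars_deg0 f z)).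
  by rewrite EE Lop_tens tE.
pose Dl : {linear T -> T} := HB.pack D (GRing.isLinear.Build _ _ _ _ _ Dlin).
have -> : D = \sum_j c j *: G j.
  apply: funext => z; rewrite -[LHS]/(D (id z)) idE !sum_scale_fun.
  rewrite -[LHS]/(Dl _) linear_sum; apply: eq_bigr => j _.
  by rewrite linearZ /= -(GE j).2.
by apply: lspan_sum => j _; apply: lspanZ; case: (GE j).
Qed.

(** Together these span the left ideal generated by the values of the p-fold
    contractions on T. *)
Let ideal_gen : set (Tbar V) := [set x | exists (s : Sinf)
  (f : p.-tuple 'Hom(V, K^o)) (z : T),
  Sn n s /\ x = perm_elt s * Lstars f (\val z)].

Lemma ideal_gen_deg0 x : lspan ideal_gen x -> lspan (Tgen 0 n) x.
Proof.
apply: (@lspan_img _ _ _ id) => [a y y' //|_ [s [f [z [hs ->]]]]].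
by apply: (@Lperm_stable K V s n 0 n) => //; exact: Lstars_deg0.
Qed.

Lemma ideal_right_unit : n`!%:R != 0 :> K ->
  exists2 a : Tbar V, lspan ideal_gen a &
    forall y, lspan ideal_gen y -> y * a = y.
Proof.
move=> n0; pose rho (s : 'S_n) : Tbar V := perm_elt (Sinf_of_perm s).
have [||||s y|y|a aJ aE] :=
    @left_ideal_right_unit K (Tbar V) _ rho (lspanp ideal_gen).
- by rewrite card_Sn.
- by rewrite /rho Sinf_of_perm1.
- by move=> s t; rewrite /rho Sinf_of_permM perm_eltM.
- exact: lspanp_submod.
- move=> /asboolP yJ; apply/asboolP; move: y yJ.
  apply: (lspan_img (f := fun y => rho s * y)); first exact: tmul_linearr.
  move=> _ [t [f [z [ht ->]]]]; apply: lspan_gen.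
  exists (Sinf_of_perm s * t)%g, f, z; split.
    by apply: SnM ht; exact: Sn_Sinf_of_perm.
  by rewrite mulrA -perm_eltM.
- move=> /asboolP/ideal_gen_deg0/lspan_Tgen0[N [c [r [hr ->]]]].
  have /choice[s sE] j := Sinf_of_perm_surj (hr j).
  exists (fun t => \sum_(j | s j == t) c j).
  rewrite (partition_big s predT) //=; apply: eq_bigr => t _.
  rewrite scaler_suml; apply: eq_bigr => j /eqP <-.
  by rewrite /rho sE.
exists a; first exact/asboolP.
by move=> y yJ; apply: aE; apply/asboolP.
Qed.

(** The right unit of the ideal writes each z in T as a combination of vectors
    G_j(x_j), where the x_j are fixed and only the operators G_j of L_p depend
    on z; D moves past the latter, which leaves the same expression in the
    D(x_j). *)
Lemma commutant_Lset_sub : p`!%:R != 0 :> K -> n`!%:R != 0 :> K ->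
  commutant (Lset V p q p) `<=` Rset V p q.
Proof.
move=> p0 n0 D [Dlin Dcomm].
pose Dl : {linear T -> T} := HB.pack D (GRing.isLinear.Build _ _ _ _ _ Dlin).
have [a [N [c [y [hy aE]]]] unita] := ideal_right_unit n0.
have za z : \val z * a = \val z.
  have [M [d [E [hE idE]]]] := @Lset_id K V p q p0.
  have -> : \val z = \sum_j d j *: \val (E j z) by rewrite -val_sum_scale -idE.
  rewrite mulr_suml; apply: eq_bigr => j _; rewrite -scalerAl; congr (_ *: _).
  have [v [s [f [hs EE]]]] := hE j.
  rewrite EE Lop_tens -mulrA unita //; apply: lspan_gen.
  by exists 1%g, f, z; rewrite mul1r.
have /choice[s /choice[f /choice[x yE]]] := hy.
pose b := \sum_j c j *: (perm_elt (s j) * Lstars (f j) (\val (D (x j)))).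
have [|R hR RE] := @Rset_mul b.
  apply: ideal_gen_deg0; apply: lspan_sum => j _; apply/lspanZ/lspan_gen.
  exists (s j), (f j), (D (x j)).
  split; [exact: (yE j).1|by []].
suff -> : D = R by [].
apply: funext => z.
have /choice[G GE] j : exists G, Lset V p q p G /\
    forall z', \val (G z') = (\val z * perm_elt (s j)) * Lstars (f j) (\val z').
  have [E EE] := @Rperm_Tpq K V (s j) p q (yE j).1.
  have [G hG GE] := Lset_tens (f j) (TpqP (E z)).
  by exists G; split; [exact: hG|move=> z'; rewrite GE EE].
have zE : z = \sum_j c j *: G j (x j).
  apply: val_inj; rewrite val_sumZ -[LHS]za {1}aE mulr_sumr.
  apply: eq_bigr => j _.
  by rewrite -scalerAr (yE j).2 mulrA -(GE j).2.
have DzE : D z = \sum_j c j *: G j (D (x j)).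
  rewrite {1}zE -[D _]/(Dl _) linear_sum; apply: eq_bigr => j _.
  by rewrite linearZ /= -[D _]/((D \o G j) (x j)) (Dcomm _ (GE j).1).
apply: val_inj; rewrite RE DzE val_sumZ mulr_sumr; apply: eq_bigr => j _.
by rewrite (GE j).2 -scalerAr mulrA.
Qed.

End Commutants.

Theorem theorem3p1 (R : realType) (V : vectType R[i]) (p q : nat) :
  ((forall l : nat, (l < p)%N -> Lset V p q l `<=` Lset V p q l.+1) /\
   (forall l : nat, (p < l)%N -> Lset V p q l = [set 0])) /\
  (commutant (Rset V p q) = Lset V p q p /\
   commutant (Lset V p q p) = Rset V p q).
Proof.
have nz m : (0 < m)%N -> m%:R != 0 :> R[i].
  by move=> m0; rewrite Num.Theory.pnatr_eq0 -lt0n.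
split; split.
- by move=> l lp; apply: Lset_succ => //; rewrite nz ?subn_gt0.
- by move=> l; exact: Lset_zero.
- apply/seteqP; split; last exact: Lset_sub_commutant.
  by apply: commutant_Rset_sub; rewrite nz ?fact_gt0.
- apply/seteqP; split; last exact: Rset_sub_commutant.
  by apply: commutant_Lset_sub; rewrite nz ?fact_gt0.
Qed.
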